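(* Fix an admissible control $\pi\in\mathcal A(x_0)$, and let $Z_\pi(b)=E^{P^b}\left[\int_0^T g(t,X_t^\pi,\pi_t)\,dt+h(X_T^\pi)\right]$ for $b\in\mathbb R^m$. Assume that for every $\lambda>0$ the integral $\int_{\mathbb R^m}\exp\left(-\frac{Z_\pi(b)}{\lambda}\right)\mu(db)$ is well-defined in $(0,\infty]$. Let $$\mathcal R_\delta(\pi)=\inf\left\{\int_{\mathbb R^m}Z_\pi(b)\,\nu(db):\ \nu\in\mathcal P(\mathbb R^m),\ \mathrm{KL}(\nu\|\mu)\le\delta\right\}.$$ Then $$\mathcal R_\delta(\pi)=\sup_{\lambda\ge 0}\left\{-\lambda\delta-\lambda\log\left(\int_{\mathbb R^m}\exp\left(-\frac{Z_\pi(b)}{\lambda}\right)\mu(db)\right)\right\},$$ where the function of $\lambda$ in braces is extended to $\lambda=0$ by the value $\operatorname{ess\,inf}_{b\sim\mu}Z_\pi(b)$, the essential infimum of the random variable $Z_\pi(b)$ with $b\sim\mu$.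
   Context: Setting. $(\Omega,\tilde{\mathcal F},P)$ is a complete probability space supporting an $\mathbb R^{m'}$-valued Brownian motion $W$ and a random vector $B\in\mathbb R^m$, independent of $W$ under $P$, with law $\mu\in\mathcal P(\mathbb R^m)$ (the baseline prior). $\mathcal G_t$ is the augmentation of $\sigma(B,W_s:0\le s\le t)$, and the observation filtration $\mathcal F=(\mathcal F_t)$ satisfies the usual conditions and $\mathcal F_t\subseteq\mathcal G_t$. An admissible control $\pi\in\mathcal A(x_0)$ is an $\mathcal F$-progressively measurable process with values in $U\subset\mathbb R^k$ and $\int_0^T\|\pi_t\|_2^2\,dt<\infty$ $P$-a.s. The controlled state $X^\pi$ with values in $\mathbb R^d$ solves $dX_t=a(t,B,X_t,\pi_t)\,dt+b(t,B,X_t,\pi_t)^\top dW_t$, $X_0=x_0$, where the coefficients $a,b$ are such that the equation is well-posed with $\mathcal F$-adapted solution. $g$ is a running reward and $h$ a terminal reward. $\{P^b\}_{b\in\mathbb R^m}$ is a regular conditional probability of $P$ given $B=b$. It is assumed throughout that all integrability conditions needed for the expectations that appear are satisfied. $\delta\ge 0$ is the radius of the ambiguity set. $\mathrm{KL}(\nu\|\mu)=\int\log\left(\frac{d\nu}{d\mu}\right)d\nu$ if $\nu\ll\mu$, and $+\infty$ otherwise. $\mathcal P(\mathbb R^m)$ is the set of Borel probability measures on $\mathbb R^m$.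
   Formalization: For δ = 0 it is additionally assumed that ∫exp(-Z_π/λ)dμ is finite for some λ > 0; without this the claim fails, e.g. μ Gaussian and Z_π(b) = -|b|³, where R_0 is finite but the right side is -∞. *)

(* Defs.v *)
From HB Require Import structures.
From mathcomp Require Import all_boot all_order all_algebra.
From mathcomp Require Import all_classical all_reals all_analysis ess_sup_inf.

Set Implicit Arguments.
Unset Strict Implicit.
Unset Printing Implicit Defensive.

Import Order.TTheory GRing.Theory Num.Theory.
Import numFieldNormedType.Exports.

Local Open Scope classical_set_scope.
Local Open Scope ring_scope.
Local Open Scope charge_scope.

(* Conventions.
   - R^n is [n.-tuple R], whose (library) product sigma-algebra is the Borel one.
   - The complete probability space is the P-completion of (Omega, P), with
     Omega an arbitrary measurable space (so Omega may itself be complete).  The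
     completed sigma-algebra only enters through [P.-negligible] and [{ae P, _}]:
     sub-sigma-algebras such as G_t are sets of subsets of Omega that may contain
     negligible non-measurable sets.  The regular conditional probability lives
     on the uncompleted sigma-algebra of Omega: a countably additive P^b defined
     on all P-negligible sets need not exist.
   - The library integral of a function that agrees with a measurable function
     off a negligible set is the integral of the latter, i.e. the integral with
     respect to the completed measure. *)

Definition sqnorm2 (R : realType) n (v : n.-tuple R) : R :=
  \sum_(i < n) (tnth v i) ^+ 2.

Section filtrations.
Context d (Omega : measurableType d) (R : realType) (P : probability Omega R).
Variable T : R.

Definition usual_filtration (F : R -> set (set Omega)) : Prop :=
  [/\ forall t : R, 0 <= t <= T -> sigma_algebra [set: Omega] (F t),
      forall s t : R, 0 <= s -> s <= t -> t <= T -> F s `<=` F t,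
      forall (t : R) A, 0 <= t <= T -> P.-negligible A -> F t A &
      forall (t : R) A, 0 <= t < T -> (forall s : R, t < s <= T -> F s A) -> F t A].

Definition progressively_measurable dE (E : measurableType dE)
    (F : R -> set (set Omega)) (X : R -> Omega -> E) : Prop :=
  forall t : R, 0 <= t <= T -> forall C, measurable C ->
    <<s [set A : set (R * Omega) | exists2 D : set R, measurable D &
          exists2 S, F t S & A = D `*` S] >>
      [set p : R * Omega | 0 <= p.1 <= t /\ C (X p.1 p.2)].

Definition ae_continuous n (X : R -> Omega -> n.-tuple R) : Prop :=
  {ae P, forall w, forall i : 'I_n,
     {within `[0, T], continuous (fun t => tnth (X t w) i)}}.

End filtrations.

Section brownian.
Context d (Omega : measurableType d) (R : realType) (P : probability Omega R).
Context (m m' : nat) (T : R).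
Variables (W : R -> Omega -> m'.-tuple R) (B : Omega -> m.-tuple R).

Definition path_events (t : R) : set (set Omega) :=
  [set A | exists (s : R) C, [/\ 0 <= s <= t, measurable C & A = W s @^-1` C]].

Definition prior_events : set (set Omega) :=
  [set A | exists2 C, measurable C & A = B @^-1` C].

(* The last clause says at once that W_t - W_s is independent of
   sigma(W_u : u <= s) and that its law is N(0, (t - s) I). *)
Definition brownian_motion : Prop :=
  [/\ forall t : R, 0 <= t <= T -> measurable_fun [set: Omega] (W t),
      {ae P, forall w, forall j, tnth (W 0 w) j = 0},
      ae_continuous P T W &
      forall s t : R, 0 <= s -> s < t -> t <= T ->
      forall A (C : 'I_m' -> set R), <<s path_events s >> A ->
      (forall j, measurable (C j)) ->
      (P (A `&` [set w | forall j, C j (tnth (W t w) j - tnth (W s w) j)%R]) =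
       P A * \prod_(j < m') normal_prob 0%R (Num.sqrt (t - s)%R) (C j))%E].

Definition independent_of_noise : Prop :=
  forall A C, prior_events A -> <<s path_events T >> C ->
  (P (A `&` C) = P A * P C)%E.

Definition augmented_filtration (t : R) : set (set Omega) :=
  <<s prior_events `|` path_events t `|` [set N | P.-negligible N] >>.

End brownian.

Section ito.
Context d (Omega : measurableType d) (R : realType) (P : probability Omega R).
Variables (T : R) (G : R -> set (set Omega)).

(* The integrand \sum_(i < si_n) si_val i * 1_]si_time i, si_time i.+1] *)
Record simple_integrand := SimpleIntegrand {
  si_n : nat ;
  si_time : nat -> R ;
  si_val : nat -> Omega -> R ;
  _ : 0 <= si_time 0 /\ si_time si_n <= T ;
  _ : forall i, (i < si_n)%N -> si_time i <= si_time i.+1 ;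
  _ : forall i, (i < si_n)%N -> exists K, forall w, `|si_val i w| <= K ;
  _ : forall i (C : set R), (i < si_n)%N -> measurable C ->
        G (si_time i) (si_val i @^-1` C) }.

Definition si_process (H : simple_integrand) (t : R) (w : Omega) : R :=
  \sum_(i < si_n H) si_val H i w * \1_(`]si_time H i, si_time H i.+1]) t.

Definition si_integral (H : simple_integrand) (v : R -> Omega -> R)
    (t : R) (w : Omega) : R :=
  \sum_(i < si_n H) si_val H i w *
    (v (Num.min (si_time H i.+1) t) w - v (Num.min (si_time H i) t) w).

(* I is the Ito integral of H against the scalar Brownian motion v.  The usual
   definition has convergence in probability in both clauses; passing to a
   subsequence, almost sure convergence gives the same relation. *)
Definition ito_integral (v H I : R -> Omega -> R) : Prop :=
  progressively_measurable T G H /\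
  exists S : nat -> simple_integrand,
    {ae P, forall w,
       (\int[lebesgue_measure]_(t in `[0%R, T])
          ((H t w - si_process (S n) t w) ^+ 2)%:E @[n --> \oo] --> 0)%E} /\
    {ae P, forall w,
       (ereal_sup [set (`|si_integral (S n) v t w - I t w|)%:E
          | t in `[0%R, T]] @[n --> \oo] --> 0)%E}.

End ito.

Section controlled_sde.
Context d (Omega : measurableType d) (R : realType) (P : probability Omega R).
Context (m m' n k : nat) (T : R).
Variables (W : R -> Omega -> m'.-tuple R) (B : Omega -> m.-tuple R).
Variable F : R -> set (set Omega).
Variable U : set (k.-tuple R).
Variable a : R -> m.-tuple R -> n.-tuple R -> k.-tuple R -> n.-tuple R.
Variable b : R -> m.-tuple R -> n.-tuple R -> k.-tuple R -> 'M[R]_(m', n).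
Variable x0 : n.-tuple R.

Definition admissible (pi : R -> Omega -> k.-tuple R) : Prop :=
  [/\ progressively_measurable T F pi,
      forall (t : R) w, 0 <= t <= T -> U (pi t w) &
      {ae P, forall w, (\int[lebesgue_measure]_(t in `[0%R, T])
         (sqnorm2 (pi t w))%:E < +oo)%E}].

(* dX = a(t, B, X, pi) dt + b(t, B, X, pi)^T dW, X_0 = x0, written
   coordinatewise; N j i is the integral of the entry (j, i) of b against W^j. *)
Definition controlled_state (pi : R -> Omega -> k.-tuple R)
    (X : R -> Omega -> n.-tuple R) : Prop :=
  [/\ progressively_measurable T F X,
      ae_continuous P T X,
      {ae P, forall w, forall i, lebesgue_measure.-integrable `[0%R, T]
         (fun t => (tnth (a t (B w) (X t w) (pi t w)) i)%:E)} &
      exists N : 'I_m' -> 'I_n -> R -> Omega -> R,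
        (forall j i, ito_integral P T (augmented_filtration P W B)
           (fun t w => tnth (W t w) j)
           (fun t w => b t (B w) (X t w) (pi t w) j i) (N j i)) /\
        {ae P, forall w, forall (t : R) i, 0 <= t <= T ->
           tnth (X t w) i = tnth x0 i +
             \int[lebesgue_measure]_(s in `[0, t])
                tnth (a s (B w) (X s w) (pi s w)) i +
             \sum_(j < m') N j i t w}].

Definition well_posed : Prop :=
  forall pi, admissible pi -> exists2 X, controlled_state pi X &
    forall X', controlled_state pi X' ->
      {ae P, forall w, forall t : R, 0 <= t <= T -> X' t w = X t w}.

End controlled_sde.

Definition regular_conditional_probability d (Omega : measurableType d)
    (R : realType) (P : probability Omega R) m (B : Omega -> m.-tuple R)
    (mu : probability (m.-tuple R) R)
    (Pb : R.-pker (m.-tuple R) ~> Omega) : Prop :=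
  forall A C, measurable A -> measurable C ->
    (P (A `&` B @^-1` C) = \int[mu]_(x in C) Pb x A)%E.

Definition reward d (Omega : measurableType d) (R : realType) n k (T : R)
    (g : R -> n.-tuple R -> k.-tuple R -> R) (h : n.-tuple R -> R)
    (X : R -> Omega -> n.-tuple R) (pi : R -> Omega -> k.-tuple R)
    (w : Omega) : \bar R :=
  (\int[lebesgue_measure]_(t in `[0%R, T]) (g t (X t w) (pi t w))%:E +
   (h (X T w))%:E)%E.

Definition cond_reward d (Omega : measurableType d) (R : realType) m n k (T : R)
    (Pb : R.-pker (m.-tuple R) ~> Omega)
    (g : R -> n.-tuple R -> k.-tuple R -> R) (h : n.-tuple R -> R)
    (X : R -> Omega -> n.-tuple R) (pi : R -> Omega -> k.-tuple R)
    (x : m.-tuple R) : \bar R :=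
  (\int[Pb x]_w reward T g h X pi w)%E.

Definition KL d (E : measurableType d) (R : realType)
    (nu mu : probability E R) : \bar R :=
  if `[< nu `<< mu >] then
    (\int[nu]_x lne (('d (charge_of_finite_measure nu) '/d mu) x))%E
  else +oo%E.

Definition robust_value d (E : measurableType d) (R : realType)
    (mu : probability E R) (Z : E -> \bar R) (delta : R) : \bar R :=
  ereal_inf [set (\int[nu]_x Z x)%E |
    nu in [set nu : probability E R | (KL nu mu <= delta%:E)%E]].

Definition exp_moment d (E : measurableType d) (R : realType)
    (mu : probability E R) (Z : E -> \bar R) (lambda : R) : \bar R :=
  (\int[mu]_x expeR (- (Z x / lambda%:E)))%E.

Definition dual_objective d (E : measurableType d) (R : realType)
    (mu : probability E R) (Z : E -> \bar R) (delta lambda : R) : \bar R :=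
  if lambda == 0 then ess_inf mu Z
  else (- (lambda * delta)%:E - lambda%:E * lne (exp_moment mu Z lambda))%E.

(* Main.v *)
(* Write KL for the entropy of nu relative to mu and M(lambda) for the integral
   of exp(-Z/lambda). The state is only measurable for the augmented filtration,
   so one first finds a null set off which the reward is measurable, and hence a
   measurable real-valued function equal to Z mu-almost everywhere.
   Weak duality is the Donsker-Varadhan bound. For delta > 0 strong duality is
   obtained from densities that are bounded and supported where Z is bounded, so
   that entropy and value are finite: the pairs (entropy, value) form a convex
   problem with a Slater point, which yields a multiplier lambda >= 0 with
   value + lambda (entropy - delta) at least the optimal value. Testing against
   exp(-Z/lambda) truncated to |Z| <= n gives the dual value at lambda > 0 as
   n grows, and testing against normalised indicators gives the essential
   infimum at lambda = 0. For delta = 0 the value is the mean of Z under mu,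
   reached by the dual function as lambda tends to infinity. *)
Require Import Defs.
From HB Require Import structures.
From mathcomp Require Import all_boot all_order all_algebra.
From mathcomp Require Import all_classical all_reals all_analysis.
From mathcomp Require Import measurable_realfun ess_sup_inf.
From mathcomp Require Import ring lra.

Set Implicit Arguments.
Unset Strict Implicit.
Unset Printing Implicit Defensive.

Import Order.TTheory GRing.Theory Num.Theory.
Import numFieldNormedType.Exports.

Local Open Scope classical_set_scope.
Local Open Scope ring_scope.

(** * Integrals of non-measurable functions *)

Section integral_ae.
Context d (E : measurableType d) (R : realType).
Variable mu : {measure set E -> \bar R}.
Implicit Types f g : E -> \bar R.
Local Open Scope ereal_scope.

Import HBNNSimple.

(* No measurability is assumed: both sides are suprema over simple functions,
   and a simple function can be set to 0 on a negligible set. *)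
Lemma ge0_ae_le_integral_nonmeas f g : (forall x, 0 <= f x) ->
  (forall x, 0 <= g x) -> {ae mu, forall x, f x <= g x} ->
  \int[mu]_x f x <= \int[mu]_x g x.
Proof.
move=> f0 g0 [N [mN muN fgN]].
rewrite !ge0_integralTE//; apply: ge_ereal_sup => _ [h /= hf <-].
pose h' := proj_nnsfun h (measurableC mN).
have <- : sintegral mu h' = sintegral mu h.
  rewrite -!integralT_nnsfun; apply: ge0_ae_eq_integral => //.
  - exact/measurable_EFinP.
  - exact/measurable_EFinP.
  - by move=> x _; rewrite lee_fin.
  - by move=> x _; rewrite lee_fin.
  - exists N; split => // x /= hh'; apply: contrapT => Nx; apply: hh' => _.
    by rewrite /= mindicE mem_set// mulr1.
apply: ereal_sup_ubound; exists h' => // x /=; rewrite mindicE.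
have [xN|xN] := boolP (x \in ~` N); last by rewrite mulr0.
rewrite mulr1 (le_trans (hf x))//; apply: contrapT => fg.
by move/set_mem: xN; apply; exact: fgN.
Qed.

Lemma ae_le_integral_nonmeas f g : {ae mu, forall x, f x <= g x} ->
  \int[mu]_x f x <= \int[mu]_x g x.
Proof.
move=> fg; rewrite integralE [leRHS]integralE leeB//;
    apply: ge0_ae_le_integral_nonmeas => //; apply: filterS fg => x fgx.
  by rewrite !funeposE ge_max !le_max fgx lexx orbT.
by rewrite !funenegE ge_max !le_max leeN2 fgx lexx orbT.
Qed.

Lemma ae_eq_integral_nonmeas f g : {ae mu, forall x, f x = g x} ->
  \int[mu]_x f x = \int[mu]_x g x.
Proof.
by move=> fg; apply/eqP; rewrite eq_le !ae_le_integral_nonmeas//;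
  apply: filterS fg => x ->.
Qed.

End integral_ae.

(** * A measurable version of the conditional reward *)

Section measurable_off_null.
Context d d' (Omega : measurableType d) (E : measurableType d') (R : realType).
Variables (P : probability Omega R) (p : E -> Omega).
Hypothesis mp : measurable_fun [set: E] p.

(* With p the identity this is the completed sigma-algebra of Omega; with p the
   second projection of R * Omega, the exceptional times share one null set. *)
Definition measurable_off_null (A : set E) : Prop :=
  exists N, [/\ measurable N, P N = 0%E & measurable (A `\` p @^-1` N)].

Let mpre N : measurable N -> measurable (p @^-1` N).
Proof. by move=> mN; rewrite -[X in measurable X]setTI; exact: mp. Qed.

Lemma measurable_off_null_measurable A :
  measurable A -> measurable_off_null A.
Proof.
by move=> mA; exists set0; split; rewrite ?measure0// preimage_set0 setD0.
Qed.

Lemma null_bigcup (N : nat -> set Omega) : (forall n, measurable (N n)) ->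
  (forall n, P (N n) = 0%E) -> P (\bigcup_n N n) = 0%E.
Proof.
move=> mN N0; apply/negligibleP; first exact: bigcupT_measurable.
by apply: negligible_bigcup => n; apply/negligibleP; [exact: mN|exact: N0].
Qed.

(** A complement keeps the null set of the original; a countable union takes the union of the null
    sets. *)
Lemma sigma_algebra_measurable_off_null :
  sigma_algebra [set: E] measurable_off_null.
Proof.
split.
- exact: measurable_off_null_measurable.
- move=> A [N [mN N0 mA]]; exists N; split => //.
  rewrite setTD (_ : _ `\` _ = ~` (p @^-1` N) `\` (A `\` p @^-1` N)).
    by apply: measurableD => //; apply: measurableC; exact: mpre.
  apply/seteqP; split => [x [Ax Nx]|x [Nx ANx]]; split => //; first by case.
  by move=> Ax; apply: ANx.
- move=> A /choice[N HN]; exists (\bigcup_n N n); split.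
  + by apply: bigcupT_measurable => n; have [] := HN n.
  + by apply: null_bigcup => n; have [] := HN n.
  + have mU : measurable (p @^-1` (\bigcup_n N n)).
      by apply: mpre; apply: bigcupT_measurable => n; have [] := HN n.
    rewrite (_ : _ `\` _ =
      (\bigcup_n (A n `\` p @^-1` N n)) `\` p @^-1` (\bigcup_n N n)).
      apply: measurableD => //; apply: bigcupT_measurable => n.
      by have [] := HN n.
    apply/seteqP; split => [x [[n _ An] Nx]|x [[n _ [An _]] Nx]].
      by split => //; exists n => //; split => // ?; apply: Nx; exists n.
    by split => //; exists n.
Qed.

(* Countably many sublevel sets suffice, so one null set serves them all. *)
Lemma measurable_fun_off_null (D : set E) (f : E -> R) : measurable D ->
  (forall c : R, measurable_off_null [set e | D e /\ f e < c]) ->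
  exists N, [/\ measurable N, P N = 0%E &
    measurable_fun [set: E] (f \_ (D `\` p @^-1` N))].
Proof.
move=> mD /(_ (ratr (odflt 0 (unpickle _)))) mf.
have /choice[N HN] : forall n : nat, exists N, [/\ measurable N, P N = 0%E &
    measurable ([set e | D e /\ f e < ratr (odflt 0 (unpickle n))]
      `\` p @^-1` N)] by move=> n; exact: mf.
have mU : measurable (\bigcup_n N n).
  by apply: bigcupT_measurable => n; have [] := HN n.
exists (\bigcup_n N n); split => //.
  by apply: null_bigcup => n; have [] := HN n.
have mDN : measurable (D `\` p @^-1` (\bigcup_n N n)).
  by apply: measurableD => //; exact: mpre.
apply/(measurable_restrictT f mDN).
apply: (measurability _ (RGenInftyO.measurableE R)) => //= _ [_ [c ->] <-].
rewrite (_ : _ `&` _ = (\bigcup_(n in [set n : nat |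
    ratr (odflt 0 (unpickle n)) < c :> R])
   ([set e | D e /\ f e < ratr (odflt 0 (unpickle n))] `\` p @^-1` N n))
   `\` p @^-1` (\bigcup_n N n)).
  apply: measurableD; last exact: mpre.
  by apply: bigcup_measurable => n _; have [] := HN n.
apply/seteqP; split => [x [[Dx Nx] /=]|x [[n /= nc [[Dx fx] _]] Nx]].
  rewrite in_itv/= => fc; split => //.
  have [q] := rat_in_itvoo fc; rewrite in_itv/= => /andP[fq qc].
  exists (pickle q); rewrite /= ?pickleK//=; split => // Nq.
  by apply: Nx; exists (pickle q).
by split => //=; rewrite in_itv/= (lt_trans fx).
Qed.

End measurable_off_null.

(** * Measurability of progressive processes and of the reward off a null set *)

Section reward_version.
Context d (Omega : measurableType d) (R : realType) (P : probability Omega R).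
Context (m m' n k : nat) (T : R).
Variables (W : R -> Omega -> m'.-tuple R) (B : Omega -> m.-tuple R).
Variable F : R -> set (set Omega).

Lemma augmented_measurable_off_null (t : R) A : 0 <= t <= T ->
  (forall s : R, 0 <= s <= T -> measurable_fun [set: Omega] (W s)) ->
  measurable_fun [set: Omega] B ->
  augmented_filtration P W B t A -> measurable_off_null P id A.
Proof.
move=> /andP[t0 tT] mW mB; move: A; apply: smallest_sub.
  exact: sigma_algebra_measurable_off_null.
move=> A [[[C mC ->]|[s [C [/andP[s0 st] mC ->]]]]|[N [mN N0 AN]]].
- apply: measurable_off_null_measurable.
  by rewrite -[X in measurable X]setTI; exact: mB.
- apply: measurable_off_null_measurable.
  rewrite -[X in measurable X]setTI; apply: mW => //.
  by rewrite s0 (le_trans st).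
- exists N; split => //; rewrite preimage_id.
  by rewrite (_ : _ `\` _ = set0)//; apply/seteqP; split => // x [/AN].
Qed.

(** The progressive sigma-algebra is generated by rectangles [D x S] with [S] in [F T], and [S] is
    measurable off a null set of [Omega]. The exceptional set therefore depends on [w] alone, not on
    time. *)
Lemma progressive_version d1 d2 (E1 : measurableType d1)
    (E2 : measurableType d2) (X : R -> Omega -> E1) (Y : R -> Omega -> E2)
    (g : R * E1 * E2 -> R) : 0 <= T -> F T [set: Omega] ->
  F T `<=` measurable_off_null P id ->
  progressively_measurable T F X -> progressively_measurable T F Y ->
  measurable_fun [set: R * E1 * E2] g ->
  exists N, [/\ measurable N, P N = 0%E &
    measurable_fun [set: R * Omega]
      ((fun q : R * Omega => g (q.1, X q.1 q.2, Y q.1 q.2)) \_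
        (`[0, T] `*` setT `\` snd @^-1` N))].
Proof.
move=> T0 FT FN pX pY mg.
have T1 : 0 <= T <= T by rewrite T0 lexx.
apply: (measurable_fun_off_null (P := P) measurable_snd (D := `[0, T] `*` setT)
  (f := fun q : R * Omega => g (q.1, X q.1 q.2, Y q.1 q.2))).
  exact: measurableX.
move=> c.
pose rects := [set A : set (R * Omega) | exists2 D : set R, measurable D &
  exists2 S, F T S & A = D `*` S].
(* [R * Omega] with the sigma-algebra of the rectangles: composing with [g] becomes ordinary
   measurability on this type. *)
pose S := g_sigma_algebraType rects.
pose D : set S := `[0, T] `*` setT.
have mD : measurable D.
  by apply: sub_sigma_algebra; exists `[0, T]%classic => //; exists setT.
(* Progressive measurability says nothing outside [[0, T]], so the processes are replaced there by
   the default [point]. *)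
have mif dZ (Z : measurableType dZ) (f : R * Omega -> Z) :
    (forall C, measurable C ->
      <<s rects >> [set q : R * Omega | 0 <= q.1 <= T /\ C (f q)]) ->
    measurable_fun [set: S] (fun q : S => if q \in D then f q else point).
  move=> mf _ C mC; rewrite setTI.
  rewrite (_ : _ @^-1` _ = [set q : S | 0 <= q.1 <= T /\ C (f q)] `|`
     (~` D `&` [set q : S | C point])); last first.
    have DE (q : S) : (q \in D) = (0 <= q.1 <= T).
      by apply/idP/idP; rewrite inE /D/= in_itv/=; [case|].
    apply/seteqP; split => q /=; rewrite -DE.
      case: ifPn => qD Cq; [by left|right; split => //].
      by move=> /mem_set; rewrite (negbTE qD).
    move=> [[-> //]|[nDq Cp]].
    by have /negbTE-> : q \notin D by apply/negP => /set_mem.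
  apply: measurableU; first exact: mf.
  apply: measurableI; first exact: measurableC.
  have [Cp|Cp] := pselect (C point).
    by rewrite (_ : [set _ | _] = setT)//; apply/seteqP; split.
  by rewrite (_ : [set _ | _] = set0)//; apply/seteqP; split.
pose f1 (q : S) : R := if q \in D then q.1 else point.
pose fX (q : S) : E1 := if q \in D then X q.1 q.2 else point.
pose fY (q : S) : E2 := if q \in D then Y q.1 q.2 else point.
have mf1 : measurable_fun [set: S] f1.
  apply: mif => C mC; apply: sub_sigma_algebra.
  exists (`[0, T] `&` C); first exact: measurableI.
  exists setT => //; apply/seteqP; split => q /=.
    by rewrite in_itv/= => -[? ?].
  by rewrite in_itv/= => -[[? ?] _].
have mfX : measurable_fun [set: S] fX by apply: mif => C mC; exact: pX.
have mfY : measurable_fun [set: S] fY by apply: mif => C mC; exact: pY.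
have mG : measurable_fun [set: S] (fun q => g (f1 q, fX q, fY q)).
  apply: (measurableT_comp mg (g := fun q : S => (f1 q, fX q, fY q))).
  by apply: measurable_fun_pair => //; exact: measurable_fun_pair.
have : <<s rects >> [set q : S | D q /\ g (f1 q, fX q, fY q) < c].
  have /= := measurable_funTS mG mD (measurable_itv `]-oo, c[).
  by rewrite (_ : _ `&` _ = [set q : S | D q /\ g (f1 q, fX q, fY q) < c]).
rewrite (_ : [set q : S | _] = [set e : R * Omega | (`[0, T] `*` setT) e /\
    g (e.1, X e.1 e.2, Y e.1 e.2) < c]); last first.
  apply/seteqP; split => q /= [Dq]; rewrite /f1 /fX /fY mem_set//.
suff : <<s rects >> `<=` measurable_off_null P snd by exact.
apply: smallest_sub.
  exact: (sigma_algebra_measurable_off_null P measurable_snd).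
move=> A [C mC [A' /FN[N [mN N0 mA'N]] ->]]; exists N; split => //.
rewrite (_ : _ `\` _ = C `*` (A' `\` N)); first exact: measurableX.
by apply/seteqP; split => q /=; [move=> [[]]|move=> [? []]].
Qed.

(** Off one null set the whole path agrees with a jointly measurable version; Tonelli then makes its
    time integral measurable in [w], and the terminal reward is a section at time [T]. *)
Lemma reward_version (g : R -> n.-tuple R -> k.-tuple R -> R)
    (h : n.-tuple R -> R) (X : R -> Omega -> n.-tuple R)
    (pi : R -> Omega -> k.-tuple R) : 0 <= T -> F T [set: Omega] ->
  F T `<=` measurable_off_null P id ->
  progressively_measurable T F X -> progressively_measurable T F pi ->
  measurable_fun [set: R * n.-tuple R * k.-tuple R]
    (fun p => g p.1.1 p.1.2 p.2) ->
  measurable_fun [set: n.-tuple R] h ->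
  exists N, exists f : Omega -> \bar R, [/\ measurable N, P N = 0%E,
    measurable_fun [set: Omega] f &
    forall w, ~ N w -> reward T g h X pi w = f w].
Proof.
move=> T0 FT FN pX ppi mg mh.
have [N1 [mN1 N10 mG]] := progressive_version T0 FT FN pX ppi mg.
(* The terminal reward is read as a running reward, to be evaluated at time [T]. *)
have mh' : measurable_fun [set: R * n.-tuple R * k.-tuple R] (fun p => h p.1.2).
  by apply: measurableT_comp => //; apply: measurableT_comp.
have [N2 [mN2 N20 mH]] := progressive_version T0 FT FN pX ppi mh'.
set G := _ \_ _ in mG; set H := _ \_ _ in mH.
exists (N1 `|` N2), (fun w =>
  (\int[lebesgue_measure]_t (G (t, w))%:E + (H (T, w))%:E)%E); split.
- exact: measurableU.
- exact: null_set_setU.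
- apply: emeasurable_funD.
    (* Tonelli needs a non-negative integrand, hence the split into positive and negative parts. *)
    rewrite (_ : (fun w => _) = fun w =>
      (\int[lebesgue_measure]_t ((EFin \o G)^\+ (t, w)) -
       \int[lebesgue_measure]_t ((EFin \o G)^\- (t, w)))%E); last first.
      apply/funext => w; rewrite integralE; congr (_ - _)%E;
        by apply: eq_integral => t _; rewrite ?funeposE ?funenegE.
    apply: emeasurable_funB.
      apply: (measurable_fun_fubini_tonelli_G (m1 := lebesgue_measure)
        ((EFin \o G)^\+)%E) => //.
      by apply: measurable_funepos; exact/measurable_EFinP.
    apply: (measurable_fun_fubini_tonelli_G (m1 := lebesgue_measure)
      ((EFin \o G)^\-)%E) => //.
    by apply: measurable_funeneg; exact/measurable_EFinP.
  apply/measurable_EFinP; apply: measurableT_comp mH _.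
  exact: pair1_measurable.
- move=> w /not_orP[Nw1 Nw2]; rewrite /reward; congr (_ + _)%E.
    rewrite integral_mkcond; apply: eq_integral => t _.
    rewrite /G !patchE/=; case: ifPn => tT.
      by rewrite mem_set//; split => //; split => //; exact/set_mem.
    case: ifPn => // /set_mem[[tT' _] _].
    by move/negP: tT; case; exact/mem_set.
  rewrite /H patchE mem_set//; split => //; split => //=.
  by rewrite in_itv/= T0 lexx.
Qed.
End reward_version.

(** If [N] is null for the mixture of the [K x], then [K x N = 0] for almost every [x], and for
    those [x] the integrals of [r] and [f] coincide. *)
Lemma kernel_integral_version d d' (X : measurableType d)
    (Y : measurableType d') (R : realType) (mu : probability X R)
    (K : R.-pker X ~> Y) (r f : Y -> \bar R) (N : set Y) :
  measurable N -> (\int[mu]_x K x N = 0)%E ->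
  measurable_fun [set: Y] f -> (forall y, ~ N y -> r y = f y) ->
  {ae mu, forall x, (\int[K x]_y `|r y| < +oo)%E} ->
  exists2 z : X -> R, measurable_fun [set: X] z &
    {ae mu, forall x, (\int[K x]_y r y = (z x)%:E)%E}.
Proof.
move=> mN KN0 mf rf intr.
have aeN : {ae mu, forall x, K x N = 0%E}.
  have := iffLR (ae_eq_integral_abs mu measurableT (measurable_kernel K N mN)).
  under eq_integral do rewrite gee0_abs//.
  by move=> /(_ KN0); apply: filterS => x /(_ I).
have rfK x : K x N = 0%E -> {ae K x, forall y, r y = f y}.
  move=> KxN; exists N; split => // y /= rfy; apply: contrapT => Ny.
  by apply: rfy; exact: rf.
have mint (s : Y -> \bar R) : (forall y, 0 <= s y)%E ->
    measurable_fun [set: Y] s ->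
    measurable_fun [set: X] (fun x => \int[K x]_y s y)%E.
  move=> s0 ms; apply: (measurable_fun_integral_kernel (l := K)) => // U mU.
  exact: measurable_kernel.
exists (fun x => fine (\int[K x]_y f y)).
  apply: measurableT_comp => //.
  rewrite (_ : (fun x => _) =
    (fun x => \int[K x]_y f^\+ y - \int[K x]_y f^\- y)%E); last first.
    by apply/funext => x; rewrite integralE.
  apply: emeasurable_funB; apply: mint => //.
    exact: measurable_funepos.
  exact: measurable_funeneg.
apply: filterS2 aeN intr => x /rfK rfx.
have rfx' : {ae K x, forall y, (`|r y| = `|f y|)%E}.
  by apply: filterS rfx => y ->.
rewrite (ae_eq_integral_nonmeas rfx) (ae_eq_integral_nonmeas rfx') => intf.
rewrite fineK//; apply: integrable_fin_num => //.
by apply/integrableP.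
Qed.

Lemma cond_reward_version dO (Omega : measurableType dO) (R : realType)
    (P : probability Omega R) (m m' n k : nat) (T : R) (T0 : 0 <= T)
    (W : R -> Omega -> m'.-tuple R)
    (mW : forall t : R, 0 <= t <= T -> measurable_fun [set: Omega] (W t))
    (B : Omega -> m.-tuple R) (mB : measurable_fun [set: Omega] B)
    (mu : probability (m.-tuple R) R)
    (F : R -> set (set Omega)) (hF : usual_filtration P T F)
    (hFG : forall t : R, 0 <= t <= T -> F t `<=` augmented_filtration P W B t)
    (g : R -> n.-tuple R -> k.-tuple R -> R)
    (mg : measurable_fun [set: R * n.-tuple R * k.-tuple R]
            (fun p => g p.1.1 p.1.2 p.2))
    (h : n.-tuple R -> R) (mh : measurable_fun [set: n.-tuple R] h)
    (Pb : R.-pker (m.-tuple R) ~> Omega)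
    (hPb : regular_conditional_probability P B mu Pb)
    (pi : R -> Omega -> k.-tuple R) (hpi : progressively_measurable T F pi)
    (X : R -> Omega -> n.-tuple R) (hX : progressively_measurable T F X) :
  {ae mu, forall x, (\int[Pb x]_w `|reward T g h X pi w| < +oo)%E} ->
  exists2 z : m.-tuple R -> R, measurable_fun [set: m.-tuple R] z &
    {ae mu, forall x, cond_reward T Pb g h X pi x = (z x)%:E}.
Proof.
have T1 : 0 <= T <= T by rewrite T0 lexx.
have FT : F T [set: Omega].
  have [+ _ _ _] := hF => /(_ T T1)[F0 FC _].
  by rewrite -(setD0 [set: Omega]); exact: FC.
have FN : F T `<=` measurable_off_null P id.
  by move=> A /(hFG T T1) /(augmented_measurable_off_null T1 mW mB).
have [N [f [mN N0 mf rf]]] := reward_version T0 FT FN hX hpi mg mh.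
apply: (kernel_integral_version mN _ mf rf).
(* Disintegration over the whole space turns the mixture of the [Pb x N] into [P N]. *)
by rewrite -hPb// preimage_setT setIT.
Qed.

(** * Densities and relative entropy *)

Section real_inequalities.
Context {R : realType}.
Implicit Types x y t : R.

Lemma ln_le_sub1 x : 0 < x -> ln x <= x - 1.
Proof.
by move=> x0; rewrite -[X in ln X](subrKC 1) le_ln1Dx// ltrBrDl subrr.
Qed.

(** The convex function [y * ln y] lies above its tangent at [x]. *)
Lemma mulr_ln_ge_tangent x y : 0 < x -> 0 <= y ->
  y * ln x + y - x <= y * ln y.
Proof.
move=> x0; rewrite le_eqVlt => /predU1P[<-|y0].
  by rewrite !mul0r addr0 sub0r oppr_le0 ltW.
have := ln_le_sub1 (divr_gt0 x0 y0); rewrite ln_div ?posrE//.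
rewrite -(ler_pM2l y0) mulrBr mulrBr mulr1 (mulrC y (x / y)) divfK ?gt_eqF//.
lra.
Qed.

(** Average the tangent inequalities at the mean [z]. If [z = 0] there is no tangent, but then both
    weighted terms vanish. *)
Lemma convex_mulr_ln x y t : 0 <= x -> 0 <= y -> 0 <= t <= 1 ->
  (t * x + (1 - t) * y) * ln (t * x + (1 - t) * y) <=
  t * (x * ln x) + (1 - t) * (y * ln y).
Proof.
move=> x0 y0 /andP[t0 t1]; set z := t * x + (1 - t) * y.
have : 0 <= z by rewrite addr_ge0// mulr_ge0// subr_ge0.
rewrite le_eqVlt => /predU1P[z0|z0]; last first.
  have hx := ler_wpM2l t0 (mulr_ln_ge_tangent z0 x0).
  have t1' : 0 <= 1 - t by rewrite subr_ge0.
  have hy := ler_wpM2l t1' (mulr_ln_ge_tangent z0 y0).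
  apply: le_trans (lerD hx hy); rewrite [leLHS](_ : _ =
    t * (x * ln z + x - z) + (1 - t) * (y * ln z + y - z))//.
  by rewrite {1}/z; move: (ln z) => l; rewrite /z; ring.
have /eqP := esym z0; rewrite paddr_eq0 ?mulr_ge0 ?subr_ge0//.
rewrite -z0 mul0r => /andP[tx ty].
by rewrite !mulrA (eqP tx) (eqP ty) !mul0r addr0.
Qed.

(** The lower bound is the tangent at 1, the upper one comes from [ln x <= x - 1]. *)
Lemma mulr_ln_bound x K : 0 <= x <= K -> `|x * ln x| <= 1 + K ^+ 2.
Proof.
move=> /andP[x0 xK]; rewrite ler_norml.
have h1 := mulr_ln_ge_tangent ltr01 x0; rewrite ln1 in h1.
apply/andP; split; first by have := sqr_ge0 K; lra.
move: x0 xK; rewrite le_eqVlt => /predU1P[<- _|x0 xK].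
  by rewrite mul0r addr_ge0// sqr_ge0.
have h2 := ler_wpM2l (ltW x0) (ln_le_sub1 x0); apply: (le_trans h2).
have : x * x <= K * K by apply: ler_pM => //; exact: ltW.
by rewrite expr2; lra.
Qed.

End real_inequalities.

Section density.
Context d (E : measurableType d) (R : realType) (mu : probability E R).
Variable r : E -> R.
Hypotheses (mr : measurable_fun [set: E] r) (r0 : forall x, 0 <= r x).
Hypothesis r1 : (\int[mu]_x (r x)%:E = 1)%E.
Local Open Scope ereal_scope.

Definition density_prob (A : set E) : \bar R := \int[mu]_(x in A) (r x)%:E.

Let density_prob0 : density_prob set0 = 0.
Proof. exact: integral_set0. Qed.

Let density_prob_ge0 A : 0 <= density_prob A.
Proof. by apply: integral_ge0 => x _; rewrite lee_fin. Qed.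

Let density_prob_sigma_additive : semi_sigma_additive density_prob.
Proof.
move=> /= F mF tF mUF; rewrite /density_prob; apply: cvg_toP.
  apply: ereal_nondecreasing_is_cvgn => m n mn.
  by apply: lee_sum_nneg_natr => // k _ _; apply: integral_ge0 => /= x _;
    rewrite lee_fin.
rewrite ge0_integral_bigcup//=.
  exact/measurable_funTS/measurable_EFinP.
by move=> x _; rewrite lee_fin.
Qed.

HB.instance Definition _ := isMeasure.Build _ _ _ density_prob
  density_prob0 density_prob_ge0 density_prob_sigma_additive.

HB.instance Definition _ := @Measure_isProbability.Build _ _ R density_prob r1.

Lemma probability_of_density : exists nu : probability E R,
  forall A, measurable A -> nu A = \int[mu]_(x in A) (r x)%:E.
Proof. by exists density_prob. Qed.

End density.

(** * Radon-Nikodym densities and the entropy integral *)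

Section radon_nikodym_density.
Context d (E : measurableType d) (R : realType) (mu nu : probability E R).
Local Open Scope ereal_scope.
Hypothesis numu : nu `<< mu.

Lemma ae_null_dominates (Q : E -> Prop) :
  {ae mu, forall x, Q x} -> {ae nu, forall x, Q x}.
Proof.
move=> [N [mN N0 QN]]; exists N; split => //.
by move/null_content_dominatesP : numu; exact.
Qed.

(** A real version of the derivative that is non-negative at every point; it agrees almost
    everywhere with the charge derivative used in [KL]. *)
Definition rn_density (x : E) : R :=
  fine (Radon_Nikodym_SigmaFinite.f nu mu x).

Lemma rn_density_ge0 x : (0 <= rn_density x)%R.
Proof. exact/fine_ge0/Radon_Nikodym_SigmaFinite.f_ge0. Qed.

Lemma rn_densityE x :
  (rn_density x)%:E = Radon_Nikodym_SigmaFinite.f nu mu x.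
Proof. by rewrite fineK//; exact: Radon_Nikodym_SigmaFinite.f_fin_num. Qed.

Lemma measurable_rn_density : measurable_fun [set: E] rn_density.
Proof.
apply: measurableT_comp => //; apply: measurable_int.
exact: Radon_Nikodym_SigmaFinite.f_integrable numu.
Qed.

Lemma rn_density_change (G : E -> \bar R) : (forall x, 0 <= G x) ->
  measurable_fun [set: E] G ->
  \int[nu]_x G x = \int[mu]_x (G x * (rn_density x)%:E).
Proof.
move=> G0 mG; under [in RHS]eq_integral do rewrite rn_densityE.
by rewrite Radon_Nikodym_SigmaFinite.change_of_variables.
Qed.

(** The [nu]-mass of the zero set of the density is the integral of 0. *)
Lemma rn_density_gt0 : {ae nu, forall x, (0 < rn_density x)%R}.
Proof.
have mN : measurable [set x | rn_density x = 0%R].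
  rewrite -[X in measurable X]setTI.
  exact: (measurable_rn_density measurableT (measurable_set1 0%R)).
exists [set x | rn_density x = 0%R]; split => //.
  rewrite -(setIT [set _ | _]) -integral_indic// rn_density_change//; last first.
    by apply/measurable_EFinP; exact: measurable_indic.
  rewrite integral0_eq// => x _; rewrite indicE.
  have [/set_mem /= ->|_] := boolP (x \in _); first by rewrite mule0.
  by rewrite mul0e.
move=> x /= /negP; rewrite lt_neqAle rn_density_ge0 andbT negbK.
by move=> /eqP.
Qed.

(** The extended logarithm [lne] is matched with [ln] at positive values, and the density is
    positive [nu]-almost everywhere. *)
Lemma KL_rn_density : KL nu mu = \int[nu]_x (ln (rn_density x))%:E.
Proof.
rewrite /KL; case: asboolP => // _; apply: ae_eq_integral_nonmeas.
have := ae_eq_Radon_Nikodym_SigmaFinite numu measurableT.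
move=> /(ae_null_dominates) rnE; apply: filterS2 rnE rn_density_gt0 => x.
by move=> /(_ I) <- r0; rewrite -rn_densityE lne_EFin.
Qed.

End radon_nikodym_density.

(** * Weak duality *)

Section integrable_real.
Context d (E : measurableType d) (R : realType) (mu : probability E R).
Implicit Types f : E -> R.

Lemma EFin_Rintegral f : mu.-integrable [set: E] (EFin \o f) ->
  (\int[mu]_x (f x)%:E)%E = (\int[mu]_x f x)%:E.
Proof. by move=> intf; rewrite fineK//; exact: integrable_fin_num. Qed.

Lemma probability_integrable_cst c : mu.-integrable [set: E] (EFin \o cst c).
Proof. exact: finite_measure_integrable_cst. Qed.

Lemma Rintegral_probability_cst c : \int[mu]_(x in [set: E]) c = c.
Proof. by rewrite Rintegral_cst// [X in fine X](probability_setT mu) mulr1. Qed.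

Lemma ge0_integrable f c : measurable_fun [set: E] f -> (forall x, 0 <= f x) ->
  (\int[mu]_x (f x)%:E <= c%:E)%E -> mu.-integrable [set: E] (EFin \o f).
Proof.
move=> mf f0 fc; apply/integrableP; split; first exact/measurable_EFinP.
under eq_integral do rewrite gee0_abs ?lee_fin//.
by rewrite (le_lt_trans fc)// ltry.
Qed.

End integrable_real.

Section weak_duality.
Context d (E : measurableType d) (R : realType) (mu nu : probability E R).
Variable Z : E -> R.
Hypothesis mZ : measurable_fun [set: E] Z.
Hypothesis numu : nu `<< mu.

Local Notation r := (rn_density mu nu).

(** The negative part of [ln r] is at most [1 / r] where [r > 0], and the [nu]-integral of [1 / r]
    is the [mu]-mass of [r > 0], at most 1. The entropy bound then controls the positive part. *)
Lemma integrable_ln_density delta : (KL nu mu <= delta%:E)%E ->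
  nu.-integrable [set: E] (EFin \o (@ln R \o r)).
Proof.
have mr := measurable_rn_density numu.
have mlr : measurable_fun [set: E] (EFin \o (@ln R \o r)).
  by apply/measurable_EFinP; exact: measurableT_comp.
have mrV : measurable_fun [set: E] (fun x => expR (- ln (r x))).
  by do 3 apply: measurableT_comp => //.
have neg_le : (\int[nu]_x ((EFin \o (@ln R \o r))^\- x) <= 1)%E.
  apply: (@le_trans _ _ (\int[nu]_x (expR (- ln (r x)))%:E)%E).
    apply: ge0_ae_le_integral_nonmeas => //.
    apply: nearW => x; rewrite funenegE ge_max /= !lee_fin expR_ge0 andbT.
    by have := expR_ge1Dx (- ln (r x)); lra.
  rewrite (rn_density_change numu)//; last exact/measurable_EFinP.
  apply: (@le_trans _ _ (\int[mu]_x (cst 1%E x))%E).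
    apply: ge0_ae_le_integral_nonmeas => //.
      by move=> x; rewrite mule_ge0// lee_fin ?expR_ge0 ?rn_density_ge0.
    apply: nearW => x; rewrite -EFinM lee_fin.
    have := rn_density_ge0 numu x; rewrite le_eqVlt => /predU1P[<-|r0].
      by rewrite mulr0.
    by rewrite expRN lnK ?posrE// mulVf ?gt_eqF.
  by rewrite integral_cst// mul1e [leLHS](probability_setT mu).
rewrite KL_rn_density// integralE => KLd.
apply/integrableP; split => //.
rewrite (_ : (fun x => _) = (fun x => (EFin \o (@ln R \o r))^\+ x +
   (EFin \o (@ln R \o r))^\- x)%E); last first.
  by rewrite -[RHS]/((EFin \o (@ln R \o r))^\+ \+
    (EFin \o (@ln R \o r))^\-)%E -fune_abse.
rewrite ge0_integralD//; [|exact: measurable_funepos|exact: measurable_funeneg].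
apply: lte_add_pinfty; last by rewrite (le_lt_trans neg_le)// ltry.
apply: (@le_lt_trans _ _ (delta%:E + 1)%E); last by rewrite ltry.
have negfin : (\int[nu]_x ((EFin \o (@ln R \o r))^\- x))%E \is a fin_num.
  rewrite ge0_fin_numE ?(le_lt_trans neg_le) ?ltry//.
  by apply: integral_ge0.
by rewrite (le_trans _ (leeD KLd neg_le))// subeK.
Qed.

(* The Donsker-Varadhan bound: integrate [1 + t <= exp t] against nu, with
   exp t = exp(-Z/lambda) / (M r) of nu-integral at most 1. *)
Lemma donsker_varadhan_le (delta lambda M : R) : 0 < lambda -> 0 < M ->
  (KL nu mu <= delta%:E)%E ->
  (\int[mu]_x (expR (- (Z x / lambda)))%:E = M%:E)%E ->
  ((- (lambda * delta) - lambda * ln M)%:E <= \int[nu]_x (Z x)%:E)%E.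
Proof.
move=> l0 M0 KLd intM.
have mr := measurable_rn_density numu.
pose G x := expR (- (Z x / lambda) - ln M - ln (r x)).
have me : measurable_fun [set: E] (fun x => expR (- (Z x / lambda))).
  by do 2 apply: measurableT_comp => //; exact: measurable_funM.
have mG : measurable_fun [set: E] G.
  apply: measurableT_comp => //; apply: measurable_funB.
    apply: measurable_funB => //; apply: measurableT_comp => //.
    exact: measurable_funM.
  exact: measurableT_comp.
have G0 x : 0 <= G x by exact: expR_ge0.
have intG1 : (\int[nu]_x (G x)%:E <= 1%:E)%E.
  rewrite (rn_density_change numu)//; last exact/measurable_EFinP.
  apply: (@le_trans _ _
      (\int[mu]_x (M^-1%:E * (expR (- (Z x / lambda)))%:E))%E).
    apply: ge0_ae_le_integral_nonmeas => //.
    - by move=> x; rewrite mule_ge0// lee_fin// rn_density_ge0.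
    - by move=> x; rewrite mule_ge0// lee_fin ?expR_ge0// invr_ge0 ltW.
    apply: nearW => x; rewrite -!EFinM lee_fin /G.
    have := rn_density_ge0 numu x; rewrite le_eqVlt => /predU1P[<-|r0].
      by rewrite mulr0 mulr_ge0 ?expR_ge0// invr_ge0 ltW.
    rewrite !expRD !expRN !lnK ?posrE// mulfVK ?gt_eqF//.
    by rewrite mulrC.
  rewrite ge0_integralZl//.
  - by rewrite intM -EFinM mulVf// gt_eqF.
  - exact/measurable_EFinP.
  - by rewrite lee_fin invr_ge0 ltW.
have iG := ge0_integrable mG G0 intG1.
have il := integrable_ln_density KLd.
have icst := probability_integrable_cst nu.
(* Solving [1 + t <= exp t] for [Z], with [t] the exponent of [G], gives
   [Z >= lambda * (c - G - ln r)]. The right side is [nu]-integrable, so no integrability of [Z]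
   enters. *)
pose c : R := 1 - ln M.
have i1 : nu.-integrable [set: E] (EFin \o (fun x => c - G x)).
  rewrite (_ : _ \o _ = (EFin \o cst c) \- (EFin \o G))%E//.
  exact: integrableB.
have i2 : nu.-integrable [set: E] (EFin \o (fun x => c - G x - ln (r x))).
  rewrite (_ : _ \o _ = (EFin \o (fun x => c - G x)%R) \-
    (EFin \o (@ln R \o r)))%E//.
  exact: integrableB.
have i3 : nu.-integrable [set: E]
    (EFin \o (fun x => lambda * (c - G x - ln (r x)))).
  rewrite (_ : _ \o _ = fun x =>
    (lambda%:E * (EFin \o (fun x => c - G x - ln (r x))%R) x)%E)//.
  exact: integrableZl.
apply: (@le_trans _ _ (\int[nu]_x (lambda * (c - G x - ln (r x)))%:E)%E).
  rewrite EFin_Rintegral// lee_fin RintegralZl// RintegralB// RintegralB//.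
  rewrite Rintegral_probability_cst -mulrN -mulrBr ler_pM2l//.
    move: KLd; rewrite KL_rn_density// EFin_Rintegral// lee_fin.
    by move: intG1; rewrite EFin_Rintegral// lee_fin /c /comp; lra.
  exact: icst.
apply: ae_le_integral_nonmeas; apply: filterS (rn_density_gt0 numu) => x r0.
have := expR_ge1Dx (- (Z x / lambda) - ln M - ln (r x)); rewrite -/(G x).
by rewrite lee_fin -ler_pdivlMl// /c; lra.
Qed.

Lemma ess_inf_le_integral (f : E -> \bar R) :
  (ess_inf mu f <= \int[nu]_x f x)%E.
Proof.
rewrite -[leLHS]mule1 -(@probability_setT _ _ _ nu) -integral_cst//.
apply: ae_le_integral_nonmeas; apply: (ae_null_dominates numu).
exact: ess_inf_le.
Qed.

End weak_duality.

(** * Strong duality for a positive radius *)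

(* The multiplier is the least upper bound of the slopes (v - u x) / (e x - delta)
   over e x > delta; any point with e x < delta bounds them by convexity. *)
Lemma lagrange_multiplier (R : realType) (S : Type) (adm : S -> Prop)
    (e u : S -> R) (delta v : R) :
  (forall x y t, adm x -> adm y -> 0 <= t <= 1 -> exists z, [/\ adm z,
     e z <= t * e x + (1 - t) * e y & u z <= t * u x + (1 - t) * u y]) ->
  (exists2 x, adm x & e x < delta) ->
  (forall x, adm x -> e x <= delta -> v <= u x) ->
  exists2 lambda, 0 <= lambda &
    forall x, adm x -> v <= u x + lambda * (e x - delta).
Proof.
move=> mix [x0 ax0 ex0] vu.
(* Adding 0 makes the set non-empty and its supremum non-negative. *)
pose L := [set l | l = 0 \/ exists x, [/\ adm x, delta < e x &
  l = (v - u x) / (e x - delta)]].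
have ubL y : adm y -> e y < delta -> ubound L ((u y - v) / (delta - e y)).
  move=> ay ey l; have q0 : 0 < delta - e y by rewrite subr_gt0.
  move=> [->|[x [ax ex ->]]].
    by rewrite divr_ge0 ?subr_ge0 ?vu// ltW.
  have p0 : 0 < e x - delta by rewrite subr_gt0.
  have pq0 : 0 < (e x - delta) + (delta - e y) by rewrite addr_gt0.
  (* The weight for which [t * e x + (1 - t) * e y] is exactly [delta], so that the mixture is
     feasible. *)
  pose t := (delta - e y) / ((e x - delta) + (delta - e y)).
  have t01 : 0 <= t <= 1.
    by rewrite divr_ge0 ?(ltW q0) ?(ltW pq0)//= ler_pdivrMr// mul1r; lra.
  have [z [az ez uz]] := mix x y t ax ay t01.
  have tE : t * ((e x - delta) + (delta - e y)) = delta - e y.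
    by rewrite /t divfK// gt_eqF.
  have /(vu z az) vz : e z <= delta by apply: (le_trans ez); nra.
  rewrite ler_pdivrMr// mulrAC ler_pdivlMr//.
  have := le_trans vz uz; rewrite -(ler_pM2r pq0) => h.
  have h1 : (t * u x + (1 - t) * u y) * (e x - delta + (delta - e y)) =
    (delta - e y) * u x + (e x - delta) * u y.
    move: tE; set w := e x - delta + (delta - e y) => tE.
    transitivity (t * w * u x + (w - t * w) * u y); first by ring.
    by rewrite tE /w; ring.
  rewrite h1 in h; lra.
have supL : has_sup L.
  by split; [exists 0; left|exists ((u x0 - v) / (delta - e x0)); exact: ubL].
exists (sup L); first by apply: ub_le_sup => //; [case: supL|left].
move=> x ax; have [ex|ex|ex] := ltgtP (e x) delta.
- have := ge_sup supL.1 (ubL x ax ex).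
  by rewrite ler_pdivlMr ?subr_gt0//; lra.
- have : (v - u x) / (e x - delta) <= sup L.
    by apply: ub_le_sup; [case: supL|right; exists x].
  by rewrite ler_pdivrMr ?subr_gt0//; lra.
- by rewrite ex subrr mulr0 addr0 vu// ex.
Qed.

Section bounded_densities.
Context d (E : measurableType d) (R : realType) (mu : probability E R).
Variable Z : E -> R.
Hypothesis mZ : measurable_fun [set: E] Z.
Implicit Types r : E -> R.

(* Bounded densities under which Z is bounded: all integrals below are finite
   without any assumption on Z. *)
Definition bounded_density r : Prop :=
  [/\ measurable_fun [set: E] r, forall x, 0 <= r x,
      exists K, forall x, r x <= K /\ `|Z x * r x| <= K &
      \int[mu]_x r x = 1].

Definition density_entropy r : R := \int[mu]_x (r x * ln (r x)).

Definition density_value r : R := \int[mu]_x (Z x * r x).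

Lemma bounded_integrable (f : E -> R) K : measurable_fun [set: E] f ->
  (forall x, `|f x| <= K) -> mu.-integrable [set: E] (EFin \o f).
Proof.
move=> mf fK; apply: (le_integrable measurableT (g := EFin \o cst K)).
- exact/measurable_EFinP.
- move=> x _; rewrite /= lee_fin (le_trans (fK x))// ler_norm//.
- exact: probability_integrable_cst.
Qed.

Lemma bounded_density_integrable r : bounded_density r ->
  [/\ mu.-integrable [set: E] (EFin \o r),
      mu.-integrable [set: E] (EFin \o (fun x => r x * ln (r x))) &
      mu.-integrable [set: E] (EFin \o (fun x => Z x * r x))].
Proof.
move=> [mr r0 [K rK] _]; split.
- apply: (bounded_integrable (K := K)) => // x.
  by rewrite ger0_norm//; case: (rK x).
- apply: (bounded_integrable (K := 1 + K ^+ 2)).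
    by apply: measurable_funM => //; exact: measurableT_comp.
  by move=> x; apply: mulr_ln_bound; rewrite r0; case: (rK x).
- apply: (bounded_integrable (K := K)); first exact: measurable_funM.
  by move=> x; case: (rK x).
Qed.

(** The convexity needed for the multiplier: at the pointwise mixture the entropy is convex and the
    value affine. *)
Lemma bounded_density_mix r1 r2 t : bounded_density r1 ->
  bounded_density r2 -> 0 <= t <= 1 ->
  exists r, [/\ bounded_density r,
    density_entropy r <= t * density_entropy r1 + (1 - t) * density_entropy r2 &
    density_value r <= t * density_value r1 + (1 - t) * density_value r2].
Proof.
move=> b1 b2 /[dup] t01 /andP[t0 t1].
have [i1 e1 z1] := bounded_density_integrable b1.
have [i2 e2 z2] := bounded_density_integrable b2.
have [m1 p1 [K1 k1] s1] := b1; have [m2 p2 [K2 k2] s2] := b2.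
have t1' : 0 <= 1 - t by rewrite subr_ge0.
have intZ (f : E -> R) c : mu.-integrable [set: E] (EFin \o f) ->
    mu.-integrable [set: E] (EFin \o (fun x => c * f x)).
  by move=> fi; rewrite (_ : _ \o _ = fun x => c%:E * (EFin \o f) x)%E//;
    exact: integrableZl.
pose r x := t * r1 x + (1 - t) * r2 x.
have br : bounded_density r.
  split.
  - by apply: measurable_funD; exact: measurable_funM.
  - by move=> x; rewrite addr_ge0// mulr_ge0.
  - exists (t * K1 + (1 - t) * K2) => x; split.
      by rewrite lerD// ler_wpM2l//; [case: (k1 x)|case: (k2 x)].
    rewrite /r mulrDr !(mulrCA (Z x)) (le_trans (ler_normD _ _))// !normrM.
    by rewrite (ger0_norm t0) (ger0_norm t1') -!normrM lerD// ler_wpM2l//;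
      [case: (k1 x)|case: (k2 x)].
  - by rewrite RintegralD ?RintegralZl ?s1 ?s2//; [ring|exact: intZ..].
exists r; split => //.
- have [_ er _] := bounded_density_integrable br.
  rewrite /density_entropy -!RintegralZl// -RintegralD//; try exact: intZ.
  apply: le_Rintegral => //.
    rewrite (_ : _ \o _ = (EFin \o (fun x => t * (r1 x * ln (r1 x)))%R) \+
      (EFin \o (fun x => (1 - t) * (r2 x * ln (r2 x)))%R))%E//.
    by apply: integrableD => //; exact: intZ.
  by move=> x _; exact: convex_mulr_ln.
- rewrite /density_value -!RintegralZl// -RintegralD//; try exact: intZ.
  rewrite le_eqVlt; apply/orP; left; apply/eqP; apply: eq_Rintegral => x _.
  by rewrite /r; ring.
Qed.

End bounded_densities.

(** * From bounded densities to the dual function *)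

Section strong_duality.
Context d (E : measurableType d) (R : realType) (mu : probability E R).
Variable Z : E -> R.
Hypothesis mZ : measurable_fun [set: E] Z.
Implicit Types r : E -> R.

(** A non-negative factor commutes with taking positive and negative parts, so the change of measure
    holds for signed [V] without integrability. *)
Lemma integral_rn_density (nu : probability E R) (V : E -> R) : nu `<< mu ->
  measurable_fun [set: E] V ->
  (\int[nu]_x (V x)%:E = \int[mu]_x (V x * rn_density mu nu x)%:E)%E.
Proof.
move=> numu mV.
have r0 := rn_density_ge0 numu.
rewrite integralE [RHS]integralE; congr (_ - _)%E.
  rewrite (rn_density_change numu)//.
    apply: eq_integral => x _; rewrite !funeposE -!EFin_max -EFinM.
    by rewrite maxr_pMl// mul0r.
  by apply: measurable_funepos; exact/measurable_EFinP.
rewrite (rn_density_change numu)//.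
  apply: eq_integral => x _; rewrite !funenegE -!EFinN -!EFin_max -EFinM.
  by rewrite maxr_pMl// mul0r mulNr.
by apply: measurable_funeneg; exact/measurable_EFinP.
Qed.

Lemma rn_density_unique (nu : probability E R) r : nu `<< mu ->
  measurable_fun [set: E] r -> mu.-integrable [set: E] (EFin \o r) ->
  (forall A, measurable A -> nu A = \int[mu]_(x in A) (r x)%:E)%E ->
  {ae mu, forall x, rn_density mu nu x = r x}.
Proof.
move=> numu mr ir nuE.
have : ae_eq mu [set: E] (EFin \o rn_density mu nu) (EFin \o r).
  apply: integral_ae_eq => //.
  - rewrite (_ : _ \o _ = Radon_Nikodym_SigmaFinite.f nu mu).
      exact: Radon_Nikodym_SigmaFinite.f_integrable.
    by apply/funext => x; rewrite /= rn_densityE.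
  - exact/measurable_EFinP.
  - move=> A _ mA; rewrite -nuE//.
    rewrite (Radon_Nikodym_SigmaFinite.f_integral numu)//.
    by apply: eq_integral => x _; rewrite /= rn_densityE.
by apply: filterS => x /(_ I)[].
Qed.

Lemma KL_refl : KL mu mu = 0%E.
Proof.
have mumu : mu `<< mu by [].
have rE := rn_density_unique mumu (measurable_cst (1 : R))
  (probability_integrable_cst mu 1).
rewrite KL_rn_density// -[RHS](integral0 mu [set: E]).
apply: ae_eq_integral_nonmeas.
apply: filterS (rE _) => [x ->|A mA]; first by rewrite /= ln1.
by rewrite (integral_cst mu mA 1%E) mul1e.
Qed.

(** Links the real-valued convex problem with the infimum over measures: uniqueness of densities
    identifies the entropy and value of [r] with those of a probability measure. *)
Lemma bounded_density_feasible r : bounded_density mu Z r ->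
  exists nu : probability E R, KL nu mu = (density_entropy mu r)%:E /\
    (\int[nu]_x (Z x)%:E = (density_value mu Z r)%:E)%E.
Proof.
move=> br; have [mr r0 _ r1] := br.
have [ir er zr] := bounded_density_integrable mZ br.
have r1' : (\int[mu]_x (r x)%:E = 1)%E by rewrite EFin_Rintegral// r1.
have [nu nuE] := probability_of_density mr r0 r1'.
have numu : nu `<< mu.
  apply/null_content_dominatesP => A mA muA0; rewrite nuE//.
  by apply: null_set_integral => //; exact/measurable_EFinP/measurable_funTS.
have rE := rn_density_unique numu mr ir nuE.
have mrn := measurable_rn_density numu.
exists nu; split.
- rewrite KL_rn_density// integral_rn_density//; last exact: measurableT_comp.
  rewrite /density_entropy -EFin_Rintegral//; apply: ae_eq_integral_nonmeas.
  by apply: filterS rE => x ->; rewrite mulrC.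
- rewrite integral_rn_density// /density_value -EFin_Rintegral//.
  by apply: ae_eq_integral_nonmeas; apply: filterS rE => x ->.
Qed.

(** The density of [mu] conditioned on [A]. It serves twice: with [A] nearly full as a Slater point,
    and with [Z] small on [A] for the essential infimum. *)
Lemma indicator_density (A : set E) K a : measurable A -> 0 < a ->
  mu A = a%:E -> (forall x, A x -> `|Z x| <= K) ->
  bounded_density mu Z (fun x => a^-1 * \1_A x) /\
  density_entropy mu (fun x => a^-1 * \1_A x) = - ln a.
Proof.
move=> mA a0 muA ZK.
have mi : measurable_fun [set: E] (\1_A : E -> R) by exact: measurable_indic.
have iA : mu.-integrable [set: E] (EFin \o (\1_A : E -> R)).
  exact: integrable_indic.
have RiA : \int[mu]_x (\1_A x : R) = a.
  by rewrite /Rintegral integral_indic// setIT [X in fine X]muA.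
have aV : 0 <= a^-1 by rewrite invr_ge0 ltW.
split.
  split.
  - exact: measurable_funM.
  - by move=> x; rewrite mulr_ge0.
  - exists (a^-1 + a^-1 * `|K|) => x; rewrite indicE.
    have [/set_mem Ax|_] := boolP (x \in A); last first.
      by rewrite !mulr0 normr0 addr_ge0// mulr_ge0.
    rewrite !mulr1 normrM (ger0_norm aV) lerDl mulr_ge0//; split => //.
    rewrite mulrC ler_wpDl// ler_wpM2l// (le_trans (ZK _ Ax))// ler_norm//.
  - by rewrite RintegralZl// RiA mulVf// gt_eqF.
rewrite /density_entropy (@eq_Rintegral _ _ _ mu setT
  (fun x => (a^-1 * ln a^-1) * \1_A x)).
  rewrite RintegralZl// RiA lnV ?posrE// mulrAC mulVf ?gt_eqF// mul1r//.
move=> x _; rewrite indicE; case: (x \in A); last by rewrite !mulr0 mul0r.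
by rewrite !mulr1.
Qed.

Let level (n : nat) : set E := [set x | `|Z x| <= n%:R].

Let measurable_level n : measurable (level n).
Proof.
rewrite -[X in measurable X]setTI.
have mnZ : measurable_fun [set: E] (fun x => `|Z x|) by exact: measurableT_comp.
have := mnZ measurableT _ (measurable_itv `]-oo, n%:R]).
by rewrite (_ : _ @^-1` _ = level n)//; apply/seteqP; split => x /=;
  rewrite in_itv.
Qed.

Let level_homo : {homo level : n m / (n <= m)%N >-> (n <= m)%O}.
Proof.
move=> n m nm; apply/subsetPset => x; rewrite /level/= => /le_trans; apply.
by rewrite ler_nat.
Qed.

Let level_cover : \bigcup_n level n = [set: E].
Proof.
apply/seteqP; split => // x _; exists (Num.truncn `|Z x|).+1 => //=.
by rewrite /level/= ltW// truncnS_gt.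
Qed.

(** The Slater point: conditioning on [|Z| <= n] costs entropy [- ln (mu (level n))], which tends to
    0 because the levels exhaust the space. *)
Lemma exists_small_entropy delta : 0 < delta ->
  exists2 r, bounded_density mu Z r & density_entropy mu r < delta.
Proof.
move=> d0.
have := nondecreasing_cvg_mu (mu := mu) measurable_level
  (bigcupT_measurable _ measurable_level) level_homo.
rewrite level_cover [X in _ --> X](probability_setT mu) => cv.
have e1 : ((expR (- delta))%:E < 1)%E by rewrite lte_fin expR_lt1 oppr_lt0.
have [n hn] : exists n, ((expR (- delta))%:E < mu (level n))%E.
  apply: contrapT => /forallNP hn.
  have : (limn (mu \o level) <= (expR (- delta))%:E)%E.
    apply: lime_le; first by apply/cvg_ex; exists 1%E.
    by apply: nearW => n /=; rewrite leNgt; apply/negP.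
  by rewrite (cvg_lim _ cv)// leNgt e1.
have fA : mu (level n) = (fine (mu (level n)))%:E.
  by rewrite fineK// fin_num_measure.
have a0 : expR (- delta) < fine (mu (level n)) by rewrite -lte_fin -fA.
have [bd en] := indicator_density (measurable_level n)
  (lt_trans (expR_gt0 _) a0) fA (fun x xn => xn).
exists (fun x => (fine (mu (level n)))^-1 * \1_(level n) x) => //.
rewrite en ltrNl -ltr_expR lnK// posrE.
exact: lt_trans (expR_gt0 _) a0.
Qed.

Lemma exp_momentE (lambda : R) : lambda != 0 ->
  exp_moment mu (EFin \o Z) lambda =
  (\int[mu]_x (expR (- (Z x / lambda)))%:E)%E.
Proof.
by move=> l0; apply: eq_integral => x _; rewrite /= inver (negbTE l0).
Qed.

Let measurable_tilt (lambda : R) :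
  measurable_fun [set: E] (fun x => expR (- (Z x / lambda))).
Proof. by do 2 apply: measurableT_comp => //; exact: measurable_funM. Qed.

Let tilt_bound (lambda : R) n x : 0 < lambda ->
  0 <= expR (- (Z x / lambda)) * \1_(level n) x <= expR (n%:R / lambda).
Proof.
move=> l0; rewrite mulr_ge0 ?expR_ge0//= indicE.
have [/set_mem Zn|_] := boolP (x \in _); last by rewrite mulr0 expR_ge0.
rewrite mulr1 ler_expR -mulNr ler_pM2r ?invr_gt0//.
by have := Zn; rewrite /level/= ler_norml => /andP[? _]; lra.
Qed.

Let integrable_tilt (lambda : R) n : 0 < lambda -> mu.-integrable [set: E]
  (EFin \o (fun x => expR (- (Z x / lambda)) * \1_(level n) x)).
Proof.
move=> l0; apply: (@bounded_integrable _ _ _ mu _ (expR (n%:R / lambda))).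
  by apply: measurable_funM => //; exact: measurable_indic.
by move=> x; case/andP: (tilt_bound n x l0) => f0 fn; rewrite ger0_norm.
Qed.

(** For this truncated Gibbs density [ln r = - Z / lambda - ln M] on the level, so [Z] cancels from
    the sum of value and [lambda] times entropy. *)
Lemma tilted_density (lambda M : R) n : 0 < lambda -> 0 < M ->
  \int[mu]_x (expR (- (Z x / lambda)) * \1_(level n) x) = M ->
  let r x := M^-1 * (expR (- (Z x / lambda)) * \1_(level n) x) in
  bounded_density mu Z r /\
  density_value mu Z r + lambda * density_entropy mu r = - (lambda * ln M).
Proof.
move=> l0 M0 intM r.
have MV : 0 <= M^-1 by rewrite invr_ge0 ltW.
have mf : measurable_fun [set: E]
    (fun x => expR (- (Z x / lambda)) * \1_(level n) x).
  by apply: measurable_funM => //; exact: measurable_indic.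
have fK x := tilt_bound n x l0; have fi := integrable_tilt n l0.
have br : bounded_density mu Z r.
  split.
  - exact: measurable_funM.
  - by move=> x; rewrite mulr_ge0//; case/andP: (fK x).
  - exists (M^-1 * expR (n%:R / lambda) +
      M^-1 * (n%:R * expR (n%:R / lambda))) => x; split.
      rewrite ler_wpDr ?mulr_ge0 ?expR_ge0// ler_wpM2l//.
      by case/andP: (fK x).
    rewrite ler_wpDl ?mulr_ge0 ?expR_ge0// mulrCA normrM (ger0_norm MV).
    rewrite ler_wpM2l// normrM.
    have [xn|xn] := boolP (x \in level n).
      rewrite ler_pM//; first exact: set_mem xn.
      by case/andP: (fK x) => f0 ?; rewrite ger0_norm.
    by rewrite indicE (negbTE xn) !mulr0 normr0 mulr0 mulr_ge0 ?expR_ge0.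
  - by rewrite RintegralZl// intM mulVf// gt_eqF.
split=> //; have [ir er zr] := bounded_density_integrable mZ br.
have [_ _ _ r1] := br.
have entE : density_entropy mu r =
    \int[mu]_x ((- lambda^-1) * (Z x * r x) - ln M * r x).
  apply: eq_Rintegral => x _; rewrite /r indicE.
  case: (x \in _); last by rewrite !mulr0 mul0r subr0.
  rewrite mulr1 lnM ?posrE ?invr_gt0 ?expR_gt0// lnV ?posrE// expRK; ring.
rewrite entE RintegralB//.
- rewrite RintegralZl// RintegralZl// r1 -/(density_value mu Z r) mulr1 mulrBr mulrA.
  by rewrite mulrN divff ?gt_eqF//; ring.
- rewrite (_ : _ \o _ = fun x =>
    ((- lambda^-1)%:E * (EFin \o (fun x => Z x * r x)%R) x)%E)//.
  exact: integrableZl.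
- rewrite (_ : _ \o _ = fun x => ((ln M)%:E * (EFin \o r) x)%E)//.
  exact: integrableZl.
Qed.

(** The truncated Gibbs densities bound each truncated moment by the same constant; monotone
    convergence removes the truncation. *)
Lemma exp_moment_le (delta lambda v : R) : 0 < lambda ->
  (forall r, bounded_density mu Z r ->
     v <= density_value mu Z r + lambda * (density_entropy mu r - delta)) ->
  (\int[mu]_x (expR (- (Z x / lambda)))%:E <=
    (expR (- ((v + lambda * delta) / lambda)))%:E)%E.
Proof.
move=> l0 vr.
have cv : (\int[mu]_(x in level n) (expR (- (Z x / lambda)))%:E @[n --> \oo]
    --> \int[mu]_x (expR (- (Z x / lambda)))%:E)%E.
  rewrite -[X in integral mu X]level_cover.
  apply: ge0_nondecreasing_set_cvg_integral => //.
  by move=> n; apply: measurable_funTS; exact/measurable_EFinP.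
rewrite -(cvg_lim _ cv)//; 
  apply: lime_le; first by apply/cvg_ex; eexists; exact: cv.
apply: nearW => n.
pose f x := expR (- (Z x / lambda)) * \1_(level n) x.
have f0 x : 0 <= f x by rewrite mulr_ge0 ?expR_ge0.
have fi : mu.-integrable [set: E] (EFin \o f) by exact: integrable_tilt.
rewrite integral_mkcond (_ : integral _ _ _ = (\int[mu]_x (f x))%:E); last first.
  rewrite -EFin_Rintegral//; apply: eq_integral => x _.
  by rewrite patchE /f indicE; case: ifP => _; rewrite ?mulr1 ?mulr0.
rewrite lee_fin.
have : 0 <= \int[mu]_x f x by apply: Rintegral_ge0.
(* A level may be null, in which case there is no density to test but the bound is trivial. *)
rewrite le_eqVlt => /predU1P[<-|M0]; first exact: expR_ge0.
have [br rE] := tilted_density l0 M0 erefl.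
have := vr _ br; rewrite mulrBr addrA rE => h.
rewrite -[leLHS]lnK ?posrE// ler_expR.
by rewrite -(ler_pM2l l0) mulrN mulrCA divff ?gt_eqF//; lra.
Qed.

Lemma ess_inf_ge (v : R) :
  (forall r, bounded_density mu Z r -> v <= density_value mu Z r) ->
  (v%:E <= ess_inf mu (EFin \o Z))%E.
Proof.
move=> vr; apply/ess_infP.
(* One index governs both the gap below [v] and the truncation. On a non-null [A k] the conditional
   law would have value at most [v - 1 / (k + 1)]. *)
pose A k : set E := [set x | Z x <= v - k.+1%:R^-1] `&` level k.
have mA k : measurable (A k).
  apply: measurableI => //; rewrite -[X in measurable X]setTI.
  have := mZ measurableT (measurable_itv `]-oo, v - k.+1%:R^-1]).
  by rewrite (_ : _ @^-1` _ = [set x | Z x <= v - k.+1%:R^-1])//;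
    apply/seteqP; split => x /=; rewrite in_itv.
have A0 k : mu (A k) = 0%E.
  apply/eqP; apply: contrapT => /negP Ak0.
  have fA : mu (A k) = (fine (mu (A k)))%:E by rewrite fineK// fin_num_measure.
  have a0 : 0 < fine (mu (A k)).
    by rewrite -lte_fin -fA lt_neqAle eq_sym Ak0 measure_ge0.
  have [bd _] := indicator_density (K := k%:R) (mA k) a0 fA
    (fun x (xA : A k x) => proj2 xA).
  have := vr _ bd; apply/negP; rewrite -ltNge.
  have [ir _ zr] := bounded_density_integrable mZ bd.
  have [_ r0 _ r1] := bd.
  apply: (@le_lt_trans _ _ (v - k.+1%:R^-1)); last first.
    by rewrite ltrBlDr ltrDl invr_gt0.
  set c := v - _; have -> : c = \int[mu]_x
      (c * ((fine (mu (A k)))^-1 * \1_(A k) x)).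
    by rewrite RintegralZl// r1 mulr1.
  apply: le_Rintegral => //.
    rewrite (_ : _ \o _ = fun x => (c%:E *
      (EFin \o (fun x => (fine (mu (A k)))^-1 * \1_(A k) x)%R) x)%E)//.
    exact: integrableZl.
  move=> x _; rewrite indicE; have [/set_mem[xA _]|_] := boolP (x \in _).
    by rewrite mulr1 ler_wpM2r// invr_ge0 ltW.
  by rewrite !mulr0.
have : mu.-negligible (\bigcup_k A k).
  by apply: negligible_bigcup => k; apply/negligibleP; [exact: mA|exact: A0].
apply: negligibleS => x /= /negP; rewrite lee_fin -ltNge => Zv.
(* The first entry makes the gap [1 / (k + 1)] fit below [v - Z x], the second puts [x] in the
   level. *)
pose k := maxn (Num.truncn (v - Z x)^-1) (Num.truncn `|Z x|).+1.
exists k => //; split.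
  rewrite /= lerBrDr -lerBrDl -[leRHS]invrK lef_pV2 ?posrE ?invr_gt0 ?subr_gt0//.
  rewrite ltW// (lt_le_trans (truncnS_gt _))// ler_nat ltnS leq_max.
  by rewrite leqnn.
rewrite /level/= ltW// (lt_le_trans (truncnS_gt _))// ler_nat leq_max.
by rewrite leqnn orbT.
Qed.

Lemma exists_dual_ge (delta v : R) : 0 < delta ->
  (forall r, bounded_density mu Z r -> density_entropy mu r <= delta ->
     v <= density_value mu Z r) ->
  (forall lambda : R, 0 < lambda -> (0 < exp_moment mu (EFin \o Z) lambda)%E) ->
  exists2 lambda, 0 <= lambda &
    (v%:E <= dual_objective mu (EFin \o Z) delta lambda)%E.
Proof.
move=> d0 vr expM0.
have [] := lagrange_multiplier (adm := bounded_density mu Z)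
  (e := density_entropy mu) (u := density_value mu Z) (delta := delta) (v := v).
- by move=> r1 r2 t b1 b2 t01; exact: bounded_density_mix.
- exact: exists_small_entropy.
- exact: vr.
move=> lambda; rewrite le_eqVlt => /predU1P[<-|l0] lr.
  exists 0 => //; rewrite /dual_objective eqxx; apply: ess_inf_ge => r br.
  by have := lr r br; rewrite mul0r addr0.
exists lambda; first exact: ltW.
have Mle := exp_moment_le l0 lr; have := expM0 _ l0.
rewrite /dual_objective gt_eqF// exp_momentE ?gt_eqF// => M0.
set M := (\int[mu]_x _)%E in Mle M0 *.
(* The bound just obtained also shows that the moment is finite, so its logarithm is real. *)
have Mfin : M \is a fin_num by rewrite ge0_fin_numE ?ltW// (le_lt_trans Mle)// ltry.
move: Mle M0; rewrite -(fineK Mfin) lee_fin lte_fin => Mle M0.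
rewrite lne_EFin// -!EFinM -EFinN -EFinB lee_fin.
have : lambda * ln (fine M) <= - (v + lambda * delta).
  rewrite -ler_pdivlMl// mulrN (mulrC lambda^-1).
  by rewrite -[leRHS]expRK ler_ln ?posrE ?expR_gt0.
lra.
Qed.

End strong_duality.

(** * Radius zero *)

Section vanishing_radius.
Context {R : realType}.
Implicit Types z a b : R.

(** Convexity of exp: [-(z / b)] is the average of [-(z / a)] and 0 with weights [a / b] and
    [1 - a / b]. Both tangent inequalities are taken at [m = -(z / b)]. *)
Lemma entropic_nondecreasing z a b : 0 < a -> a <= b ->
  a * (1 - expR (- (z / a))) <= b * (1 - expR (- (z / b))).
Proof.
move=> a0 ab; have b0 := lt_le_trans a0 ab.
set m := - (z / b).
have zE : z = - (b * m) by rewrite /m mulrN opprK mulrC divfK// gt_eqF.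
have h1 := expR_ge1Dx (- (z / a) - m).
have h2 := expR_ge1Dx (- m).
have em := expR_gt0 m.
have e1 : expR (- (z / a)) = expR (- (z / a) - m) * expR m.
  by rewrite -expRD subrK.
have e2 : 1 = expR (- m) * expR m by rewrite -expRD addNr expR0.
have k1 : a * (expR m * (1 + (- (z / a) - m))) <= a * expR (- (z / a)).
  by rewrite ler_pM2l// e1 [leRHS]mulrC ler_pM2l.
have k2 : (b - a) * (expR m * (1 - m)) <= (b - a) * 1.
  by rewrite ler_wpM2l ?subr_ge0// [leRHS]e2 [leRHS]mulrC ler_pM2l.
have k3 : a * (expR m * (1 + (- (z / a) - m))) =
    expR m * (a - z - a * m).
  by field; rewrite gt_eqF.
rewrite k3 in k1; have k4 : z * expR m = - (b * m) * expR m by rewrite -zE.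
nra.
Qed.

Lemma entropic_le z a : 0 < a -> a * (1 - expR (- (z / a))) <= z.
Proof.
move=> a0; have h := expR_ge1Dx (- (z / a)).
rewrite mulrC -ler_pdivlMr//; lra.
Qed.

(** With [l = a + n], the bound [exp (z / l) >= 1 + z / l] leaves a gap of at most
    [z ^+ 2 / (l + z)]; the threshold [B] makes this at most [e]. *)
Lemma entropic_cvg z a : 0 < a ->
  (a + n%:R) * (1 - expR (- (z / (a + n%:R)))) @[n --> \oo] --> z.
Proof.
move=> a0; apply/cvgrPdist_le => /= e e0.
pose B := `|z| + z ^+ 2 / e.
exists (Num.truncn B).+1 => // n /= Bn.
set l := a + n%:R.
have Bl : B < l.
  by rewrite (lt_le_trans (truncnS_gt _))// /l ler_wpDl ?(ltW a0)// ler_nat.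
have B0 : 0 <= B by rewrite addr_ge0// divr_ge0 ?sqr_ge0// ltW.
have l0 := le_lt_trans B0 Bl.
rewrite ger0_norm ?subr_ge0 ?entropic_le//.
have lz : z ^+ 2 / e < l + z.
  by have := ler_norm (- z); rewrite normrN; move: Bl; rewrite /B; lra.
have lz0 : 0 < l + z by apply: le_lt_trans lz; rewrite divr_ge0 ?sqr_ge0// ltW.
have h := expR_ge1Dx (z / l).
have s0 : 0 < 1 + z / l.
  by rewrite -(pmulr_lgt0 _ l0) mulrDl mul1r divfK ?gt_eqF.
have h2 : expR (- (z / l)) <= l / (l + z).
  rewrite expRN -[leRHS]invrK lef_pV2 ?posrE ?expR_gt0 ?invr_gt0 ?divr_gt0//.
  by rewrite invf_div mulrDl divff ?gt_eqF.
have h3 : l * (l / (l + z)) = l - z + z ^+ 2 / (l + z).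
  by field; rewrite gt_eqF.
have h4 : z ^+ 2 / (l + z) <= e.
  by rewrite ler_pdivrMr// mulrC -ler_pdivrMr// ltW.
have := ler_wpM2l (ltW l0) h2; rewrite h3; nra.
Qed.

End vanishing_radius.

(* As lambda grows, lambda (1 - exp(-Z/lambda)) increases to Z, while
   lambda (1 - M) <= - lambda ln M for M the exponential moment. *)
Lemma expectation_le_dual d (E : measurableType d) (R : realType)
    (mu : probability E R) (Z : E -> R) (a : R) :
  measurable_fun [set: E] Z -> 0 < a ->
  (exp_moment mu (EFin \o Z) a < +oo)%E ->
  (forall lambda : R, 0 < lambda -> (0 < exp_moment mu (EFin \o Z) lambda)%E) ->
  (\int[mu]_x (Z x)%:E <= ereal_sup
    [set dual_objective mu (EFin \o Z) 0 lambda |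
      lambda in [set l : R | (0 <= l)%R]])%E.
Proof.
move=> mZ a0 afin expM0; set S := ereal_sup _.
(* The sequence starts at [a], where the exponential moment is known to be finite. *)
pose l n : R := a + n%:R.
have l0 n : 0 < l n by rewrite ltr_wpDr.
have lV0 n : l n != 0 by rewrite gt_eqF.
pose ex n x := expR (- (Z x / l n)).
pose phi n x := l n * (1 - ex n x).
have mex n : measurable_fun [set: E] (ex n).
  by do 2 apply: measurableT_comp => //; exact: measurable_funM.
have mphi n : measurable_fun [set: E] (phi n).
  by apply: measurable_funM => //; exact: measurable_funB.
have phi_mono x n m : (n <= m)%N -> phi n x <= phi m x.
  by move=> nm; apply: entropic_nondecreasing => //; rewrite lerD2l ler_nat.
have iex0 : mu.-integrable [set: E] (EFin \o ex 0%N).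
  apply/integrableP; split; first exact/measurable_EFinP.
  move: afin; rewrite exp_momentE ?gt_eqF//; apply: le_lt_trans.
  apply: ae_le_integral_nonmeas; apply: nearW => x.
  by rewrite gee0_abs ?lee_fin ?expR_ge0// /ex /l addr0.
have icst := probability_integrable_cst mu.
have iphi_ex n : mu.-integrable [set: E] (EFin \o ex n) ->
    mu.-integrable [set: E] (EFin \o phi n).
  move=> ie; rewrite (_ : _ \o _ = fun x => ((l n)%:E *
    ((EFin \o cst 1%R) \- (EFin \o ex n)) x)%E)//.
  by apply: integrableZl => //; exact: integrableB.
(* Finiteness at [a] propagates upwards: [phi 0 <= phi n] bounds [ex n] by [1 - phi 0 / l n]. *)
have iex n : mu.-integrable [set: E] (EFin \o ex n).
  apply: (le_integrable measurableT
    (g := EFin \o (fun x => 1 - (l n)^-1 * phi 0%N x))).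
  - exact/measurable_EFinP.
  - move=> x _; rewrite /= lee_fin ger0_norm ?expR_ge0//.
    apply: le_trans (ler_norm _).
    have := phi_mono x 0%N n (leq0n _); rewrite {2}/phi => h.
    have : (l n)^-1 * phi 0%N x <= 1 - ex n x by rewrite ler_pdivrMl.
    by lra.
  - rewrite (_ : _ \o _ = (EFin \o cst 1%R) \-
      (fun x => (l n)^-1%:E * (EFin \o phi 0%N) x))%E//.
    by apply: integrableB => //; apply: integrableZl => //; exact: iphi_ex.
have iphi n := iphi_ex n (iex n).
have M0 n : 0 < \int[mu]_x ex n x.
  by have := expM0 _ (l0 n); rewrite exp_momentE// (EFin_Rintegral (iex n)) lte_fin.
have phiS n : ((\int[mu]_x phi n x)%:E <= S)%E.
  apply: (@le_trans _ _ (dual_objective mu (EFin \o Z) 0 (l n))); last first.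
    by apply: ereal_sup_ubound; exists (l n) => //=; exact: ltW.
  rewrite /dual_objective (negbTE (lV0 n)) exp_momentE// (EFin_Rintegral (iex n)).
  rewrite lne_EFin// mulr0 -EFinM -EFinN -EFinB lee_fin.
  rewrite RintegralZl//; last by exact: (integrableB measurableT (icst 1) (iex n)).
  rewrite RintegralB//; last exact: icst.
  rewrite Rintegral_probability_cst oppr0 sub0r -mulrN ler_pM2l//.
  by have := ln_le_sub1 (M0 n); rewrite /ex; lra.
have [->|Sfin] := eqVneq S +oo%E; first by rewrite leey.
have {}Sfin : S \is a fin_num.
  rewrite fin_numE Sfin andbT; apply/eqP => SN.
  by have := phiS 0%N; rewrite SN.
pose C := \int[mu]_x phi 0%N x.
(* Subtracting the integrable [phi 0] makes the increasing sequence non-negative, as monotone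
   convergence requires; it is added back at the end. *)
have intg n : (\int[mu]_x (phi n x - phi 0%N x)%:E <= S - C%:E)%E.
  rewrite EFin_Rintegral;
    last exact: (integrableB measurableT (iphi n) (iphi 0%N)).
  by rewrite RintegralB// EFinB leeB.
have Zphi x : (Z x - phi 0%N x)%:E =
    limn (fun n => (phi n x - phi 0%N x)%:E).
  apply/esym/cvg_lim => //; apply: cvg_EFin; first exact: nearW.
  apply: cvgB; last exact: cvg_cst.
  exact: entropic_cvg.
have intZphi : (\int[mu]_x (Z x - phi 0%N x)%:E <= S - C%:E)%E.
  under eq_integral do rewrite Zphi.
  rewrite monotone_convergence//.
  - apply: lime_le; last exact: nearW.
    apply: ereal_nondecreasing_is_cvgn => n m nm.
    apply: ae_le_integral_nonmeas; apply: nearW => x.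
    by rewrite lee_fin lerD2r phi_mono.
  - by move=> n; apply/measurable_EFinP; exact: measurable_funB.
  - by move=> n x _; rewrite lee_fin subr_ge0 phi_mono.
  - by move=> x _ n m nm; rewrite lee_fin lerD2r phi_mono.
have iZphi : mu.-integrable [set: E] (EFin \o (fun x => Z x - phi 0%N x)).
  apply: (@ge0_integrable _ _ _ mu _ (fine (S - C%:E))).
  - exact: measurable_funB.
  - by move=> x; rewrite subr_ge0 /phi entropic_le.
  - by rewrite fineK// fin_numB Sfin.
rewrite (_ : (fun x => _) = fun x => ((Z x - phi 0%N x)%:E + (phi 0%N x)%:E)%E).
  rewrite (integralD measurableT iZphi (iphi 0%N)).
  by rewrite [X in (_ + X)%E]EFin_Rintegral// -leeBrDr.
by apply/funext => x; rewrite -EFinD subrK.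
Qed.

(** * Duality *)

Section duality.
Context d (E : measurableType d) (R : realType) (mu : probability E R).
Local Open Scope ereal_scope.

Lemma KL_null_dominates (nu : probability E R) (delta : R) :
  KL nu mu <= delta%:E -> nu `<< mu.
Proof. by rewrite /KL; case: asboolP. Qed.

Lemma dual_le_robust (Z : E -> R) (delta lambda : R) :
  measurable_fun [set: E] Z -> (0 <= lambda)%R ->
  (forall lambda : R, (0 < lambda)%R -> 0 < exp_moment mu (EFin \o Z) lambda) ->
  dual_objective mu (EFin \o Z) delta lambda <=
  robust_value mu (EFin \o Z) delta.
Proof.
move=> mZ l0 expM0; apply: le_ereal_inf_tmp => _ [nu /= KLd <-].
have numu := KL_null_dominates KLd.
rewrite /dual_objective; have [_|ln0] := eqVneq lambda 0%R.
  exact: ess_inf_le_integral.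
have {}l0 : (0 < lambda)%R by rewrite lt_neqAle eq_sym ln0.
have := expM0 _ l0.
(* An infinite moment makes the dual objective [-oo]. *)
have [->|Mfin] := eqVneq (exp_moment mu (EFin \o Z) lambda) +oo.
  by rewrite /= gt0_muley ?lte_fin// => _; rewrite leNye.
move=> M0; have {}Mfin : exp_moment mu (EFin \o Z) lambda \is a fin_num.
  by rewrite fin_numE Mfin andbT gt_eqF// (lt_trans _ M0).
move: M0; rewrite -(fineK Mfin) lte_fin => M0.
rewrite lne_EFin// -EFinM -EFinN -EFinB.
apply: (donsker_varadhan_le mZ numu l0 M0 KLd).
by rewrite -exp_momentE// fineK.
Qed.

Lemma robust_duality (Z : E -> R) (delta : R) :
  measurable_fun [set: E] Z -> (0 <= delta)%R ->
  (delta = 0%R -> exists2 lambda, (0 < lambda)%R &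
    exp_moment mu (EFin \o Z) lambda < +oo) ->
  (forall lambda : R, (0 < lambda)%R -> 0 < exp_moment mu (EFin \o Z) lambda) ->
  robust_value mu (EFin \o Z) delta = ereal_sup
    [set dual_objective mu (EFin \o Z) delta lambda |
      lambda in [set l : R | (0 <= l)%R]].
Proof.
move=> mZ d0 M00 expM0; apply/eqP; rewrite eq_le; apply/andP; split; last first.
  by apply: ge_ereal_sup => _ [lambda /= l0 <-]; exact: dual_le_robust.
have [d00|dn0] := eqVneq delta 0%R.
  have [a a0 afin] := M00 d00.
  apply: (@le_trans _ _ (\int[mu]_x (Z x)%:E)).
    (* The prior itself is feasible at radius 0. *)
    by apply: ereal_inf_lbound; exists mu => //=; rewrite KL_refl d00.
  by rewrite d00; exact: expectation_le_dual afin expM0.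
have {dn0}d0 : (0 < delta)%R by rewrite lt_neqAle eq_sym dn0.
(* Comparing with real [v] also covers an infinite robust value. *)
suff vle (v : R) : v%:E <= robust_value mu (EFin \o Z) delta ->
    v%:E <= ereal_sup [set dual_objective mu (EFin \o Z) delta lambda |
      lambda in [set l : R | (0 <= l)%R]].
  move: vle; case: (robust_value _ _ _) => [v| |] vle.
  - exact: vle.
  - by rewrite leye_eq; apply/eqP/eqyP => v v0; apply: vle; rewrite leey.
  - exact: leNye.
move=> vR; have [r br er|l l0 vl] := exists_dual_ge (v := v) mZ d0 _ expM0.
  have [nu [KLr Zr]] := bounded_density_feasible mZ br.
  rewrite -lee_fin -Zr (le_trans vR)//; apply: ereal_inf_lbound.
  by exists nu => //=; rewrite KLr lee_fin.
by apply: (le_trans vl); apply: ereal_sup_ubound; exists l.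
Qed.

(** * Invariance under changes of Z on a null set *)

Section ae_transfer.
Variables (f g : E -> \bar R).
Hypothesis fg : {ae mu, forall x, f x = g x}.

Lemma eq_exp_moment lambda : exp_moment mu f lambda = exp_moment mu g lambda.
Proof. by apply: ae_eq_integral_nonmeas; apply: filterS fg => x ->. Qed.

Lemma eq_dual_objective delta lambda :
  dual_objective mu f delta lambda = dual_objective mu g delta lambda.
Proof.
by rewrite /dual_objective eq_exp_moment (eq_ess_inf (f := f) (g := g)).
Qed.

(** A finite entropy bound forces [nu] to be dominated by [mu], so [mu]-null sets stay null for
    every feasible [nu]. *)
Lemma eq_robust_value delta : robust_value mu f delta = robust_value mu g delta.
Proof.
rewrite /robust_value; congr ereal_inf.
apply/seteqP; split => _ [nu /= KLd <-]; exists nu => //;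
  apply: ae_eq_integral_nonmeas;
  apply: (ae_null_dominates (KL_null_dominates KLd));
  by apply: filterS fg => x ->.
Qed.

End ae_transfer.

End duality.

Theorem theorem3p1 (R : realType) (dO : measure_display)
  (Omega : measurableType dO) (P : probability Omega R)
  (m m' n k : nat) (T : R) (hT : 0 < T)
  (W : R -> Omega -> m'.-tuple R) (hW : brownian_motion P T W)
  (B : Omega -> m.-tuple R) (hB : measurable_fun [set: Omega] B)
  (hBW : independent_of_noise P T W B)
  (mu : probability (m.-tuple R) R)
  (hmu : forall C, measurable C -> mu C = P (B @^-1` C))
  (F : R -> set (set Omega)) (hF : usual_filtration P T F)
  (hFG : forall t : R, 0 <= t <= T -> F t `<=` augmented_filtration P W B t)
  (U : set (k.-tuple R))
  (a : R -> m.-tuple R -> n.-tuple R -> k.-tuple R -> n.-tuple R)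
  (b : R -> m.-tuple R -> n.-tuple R -> k.-tuple R -> 'M[R]_(m', n))
  (x0 : n.-tuple R) (hab : well_posed P T W B F U a b x0)
  (g : R -> n.-tuple R -> k.-tuple R -> R)
  (hg : measurable_fun [set: R * n.-tuple R * k.-tuple R]
          (fun p => g p.1.1 p.1.2 p.2))
  (h : n.-tuple R -> R) (hh : measurable_fun [set: n.-tuple R] h)
  (Pb : R.-pker (m.-tuple R) ~> Omega)
  (hPb : regular_conditional_probability P B mu Pb)
  (delta : R) (hdelta : 0 <= delta)
  (pi : R -> Omega -> k.-tuple R) (hpi : admissible P T F U pi)
  (X : R -> Omega -> n.-tuple R)
  (hX : controlled_state P T W B F a b x0 pi X) :
  let Z := cond_reward T Pb g h X pi in
  forall
  (* integrability: E^{P^b} is defined and finite for almost every b *)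
  (hJ : {ae mu, forall x,
          (\int[Pb x]_w `|reward T g h X pi w| < +oo)%E})
  (* integrability: the expectation of Z under nu is defined *)
  (hZnu : forall nu : probability (m.-tuple R) R, (KL nu mu <= delta%:E)%E ->
      (\int[nu]_x maxe (Z x) 0 < +oo)%E \/
      (\int[nu]_x maxe (- Z x) 0 < +oo)%E)
  (* integrability: needed in the degenerate case delta = 0 only *)
  (hZ0 : delta = 0 -> exists2 lambda, 0 < lambda &
      (exp_moment mu Z lambda < +oo)%E)
  (hZexp : forall lambda : R, 0 < lambda -> (0 < exp_moment mu Z lambda)%E),
  robust_value mu Z delta =
  ereal_sup [set dual_objective mu Z delta lambda | lambda in [set l : R | 0 <= l]].
Proof.
move=> Z hJ hZnu hZ0 hZexp.
have [mW _ _ _] := hW; have [ppi _ _] := hpi; have [pX _ _ _] := hX.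
have [z mz Zz] := cond_reward_version (ltW hT) mW hB hF hFG hg hh hPb ppi pX hJ.
(* Duality is applied to the real measurable version [z], then carried back to [Z]. *)
rewrite (eq_robust_value Zz) robust_duality//.
- by congr ereal_sup; apply: eq_imagel => l _; rewrite (eq_dual_objective Zz).
- by move=> /hZ0[l l0 lfin]; exists l; rewrite // -(eq_exp_moment Zz).
- by move=> l /hZexp; rewrite (eq_exp_moment Zz).
Qed.
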